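(* Let $f:\mathbb C^2\to\mathbb C$ be a mixed polynomial function that is IKND with respect to a $C$-face diagram $D$, and let $F:\mathbb C^2\times\mathbb C\to\mathbb C$ be a deformation of $f$. (i) If $f$ is not $D$-nice, then there exists a connected neighborhood $T\subset\mathbb C$ of the origin such that for every $\varepsilon\in T$ the function $F_\varepsilon$ is not $D$-nice. (ii) If $f$ is $D$-nice, then there exists a connected neighborhood $T\subset\mathbb C$ of the origin such that for every $\varepsilon\in T$ the function $F_\varepsilon$ is $D$-nice.
   Context: Notation. A mixed polynomial function $f:\mathbb C^2\to\mathbb C$ is a finite sum $f(x)=\sum c_{\nu,\mu}x^\nu\bar x^\mu$, $c_{\nu,\mu}\in\mathbb C$, with $f(0)=0$; $\mathrm{supp}(f)=\{\nu+\mu:c_{\nu,\mu}\ne0\}$. For $A\subset\mathbb R^2$, $f_A$ is the sum of the terms of $f$ with $\nu+\mu\in A$. For $w\in(\mathbb Q_{>0})^2$, $d(w;f)=\min\{\langle w,\xi\rangle:\xi\in\mathrm{supp}(f)\}$. $V(f)=f^{-1}(0)$; $\Sigma(f)$ is the set of points where the real Jacobian of $f$ (as a map $\mathbb R^4\to\mathbb R^2$) has rank $<2$. For $I\subset\{1,2\}$, $(\mathbb C^* )^I=\{x\in\mathbb C^2:x_i\neq0\Leftrightarrow i\in I\}$ and $\mathbb R^I=\{\nu\in\mathbb R^2:\nu_i=0\ \forall i\notin I\}$. $C$-face diagrams. A $C$-face diagram in $\mathbb R^2$ is $D=\{\nu\in(\mathbb R_{\ge0})^2:\min_{\ell\in J}\ell(\nu)=1\}$,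 $J$ a nonempty finite set of linear forms with positive rational coefficients. For $w\in(\mathbb Q_{>0})^2$, $d(w;D)=\min_{\nu\in D}\langle w,\nu\rangle$ and $\Delta(w;D)$ is the subset of $D$ where it is attained. $\mathcal P(D)\subset(\mathbb Q_{>0})^2$ consists of one weight vector $w$ for each 1-face $\Delta(w;D)$ of $D$. The faces of $D$ are its 1-faces and its vertices (0-faces); a face is inner if it is not contained in a coordinate axis. IKND. $f$ is IKND with respect to $D$ if (a) $d(w;f)\ge d(w;D)$ for all $w\in\mathcal P(D)$ and (b) for every inner face $\Delta$ of $D$ and every nonempty $I\subset\{1,2\}$ with $\Delta\cap\mathbb R^I\ne\emptyset$, $\Sigma(f_\Delta)\cap V(f_\Delta)\cap(\mathbb C^* )^I=\emptyset$. Niceness. A mixed polynomial function $g$ is $D$-nice if for every inner $0$-face $\Delta$ of $D$, $V(g_\Delta)\cap(\mathbb C^* )^2=\emptyset$. Deformations. A deformation of $f$ is a map $F:\mathbb C^2\times\mathbb C\to\mathbb C$, $F_\varepsilon(x)=F(x,\varepsilon)$, with $F_0=f$, $F_\varepsilon(0)=0$, each $F_\varepsilon$ a mixed polynomial function with coefficients depending real-analytically on $\varepsilon$. *)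

(* Defs.v *)
From HB Require Import structures.
From mathcomp Require Import all_boot all_order all_algebra.
From mathcomp Require Import finmap.
From mathcomp Require Import complex.
From mathcomp Require Import all_classical all_reals all_analysis.

Set Implicit Arguments.
Unset Strict Implicit.
Unset Printing Implicit Defensive.

Import Order.TTheory GRing.Theory Num.Theory.
Import numFieldNormedType.Exports.

Local Open Scope classical_set_scope.
Local Open Scope ring_scope.
Local Open Scope complex_scope.

(* A pair [m = (nu, mu)] is the exponent of the monomial [x^nu * conj(x)^mu]. *)
Notation exponent := ('rV[nat]_2 * 'rV[nat]_2)%type.

(* A mixed polynomial is given by its finitely supported family of
   coefficients, which the function [meval f] determines uniquely.
   The condition f(0) = 0 is imposed separately. *)
Definition mixedPoly (R : realType) : Type :=
  {fsfun exponent -> R[i] with (0 : R[i])}.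

Definition meval (R : realType) (f : mixedPoly R) (x : 'rV[R[i]]_2) : R[i] :=
  \sum_(m <- finsupp f)
    f m * \prod_(i < 2) (x 0 i ^+ m.1 0 i * ((x 0 i)^*)%C ^+ m.2 0 i).

Definition expsum (R : realType) (m : exponent) : 'rV[R]_2 :=
  \row_(i < 2) ((m.1 0 i)%:R + (m.2 0 i)%:R).

Definition msupport (R : realType) (f : mixedPoly R) : set 'rV[R]_2 :=
  [set expsum R m | m in [set m | f m != 0]].

Definition mpart (R : realType) (A : set 'rV[R]_2) (f : mixedPoly R) :
    mixedPoly R :=
  [fsfun m in finsupp f => if `[< A (expsum R m) >] then f m else 0].

Definition zeros (R : realType) (f : mixedPoly R) : set 'rV[R[i]]_2 :=
  [set x | meval f x = 0].

(* C^2 is identified with R^4 by x |-> (Re x_1, Re x_2, Im x_1, Im x_2), and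
   C with R^2 by z |-> (Re z, Im z). *)
Definition C2_to_R4 (R : realType) (x : 'rV[R[i]]_2) : 'rV[R]_(2 + 2) :=
  row_mx (\row_(i < 2) complex.Re (x 0 i)) (\row_(i < 2) complex.Im (x 0 i)).

Definition R4_to_C2 (R : realType) (u : 'rV[R]_(2 + 2)) : 'rV[R[i]]_2 :=
  \row_(i < 2) (u 0 (lshift 2 i) +i* u 0 (rshift 2 i)).

Definition C_to_R2 (R : realType) (z : R[i]) : 'rV[R]_2 :=
  \row_(j < 2) (if j == 0 then complex.Re z else complex.Im z).

Definition realification (R : realType) (f : mixedPoly R) (u : 'rV[R]_(2 + 2)) :
    'rV[R]_2 :=
  C_to_R2 (meval f (R4_to_C2 u)).

Definition critical (R : realType) (f : mixedPoly R) : set 'rV[R[i]]_2 :=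
  [set x | (\rank (jacobian (realification f) (C2_to_R4 x)) < 2)%N].

Definition Cstar (R : realType) (I : {set 'I_2}) : set 'rV[R[i]]_2 :=
  [set x | forall i : 'I_2, (x 0 i != 0) <-> (i \in I)].

Definition coord_subspace (R : realType) (I : {set 'I_2}) : set 'rV[R]_2 :=
  [set v | forall i : 'I_2, i \notin I -> v 0 i = 0].

Definition pos_weight (w : 'rV[rat]_2) : Prop := forall i : 'I_2, 0 < w 0 i.

Definition pairing (R : realType) (w : 'rV[rat]_2) (v : 'rV[R]_2) : R :=
  \sum_(i < 2) ratr (w 0 i) * v 0 i.

(* Minima are written as infima in the extended reals: they are attained on
   the finite set J, on the support of a nonzero mixed polynomial and on a
   C-face diagram; the minimum over the empty set is +oo. *)
Definition Cface_diagram (R : realType) (D : set 'rV[R]_2) : Prop :=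
  exists J : {fset 'rV[rat]_2},
    [/\ J != fset0, (forall l, l \in J -> pos_weight l) &
        D = [set v : 'rV[R]_2 | (forall i : 'I_2, 0 <= v 0 i) /\
                     ereal_inf [set (pairing l v)%:E | l in [set` J]] = 1%:E]].

(* d(w; f) is [wdeg w (msupport f)], and d(w; D) is [wdeg w D]. *)
Definition wdeg (R : realType) (w : 'rV[rat]_2) (A : set 'rV[R]_2) : \bar R :=
  ereal_inf [set (pairing w v)%:E | v in A].

Definition face_of (R : realType) (w : 'rV[rat]_2) (D : set 'rV[R]_2) :
    set 'rV[R]_2 :=
  [set v | D v /\ (pairing w v)%:E = wdeg w D].

(* The faces [face_of w D] of a C-face diagram are points or segments, so a
   face is 1-dimensional as soon as it has two distinct points. *)
Definition one_face (R : realType) (D X : set 'rV[R]_2) : Prop :=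
  (exists2 w, pos_weight w & X = face_of w D) /\
  (exists u v, [/\ X u, X v & u <> v]).

Definition zero_face (R : realType) (D X : set 'rV[R]_2) : Prop :=
  (exists2 w, pos_weight w & X = face_of w D) /\ (exists v, X = [set v]).

Definition face (R : realType) (D X : set 'rV[R]_2) : Prop :=
  one_face D X \/ zero_face D X.

Definition inner (R : realType) (X : set 'rV[R]_2) : Prop :=
  ~ exists i : 'I_2, X `<=` coord_subspace [set i]%SET.

(* P is a valid choice of P(D): one weight vector for each 1-face. *)
Definition weight_system (R : realType) (D : set 'rV[R]_2)
    (P : set 'rV[rat]_2) : Prop :=
  (forall w, P w -> pos_weight w /\ one_face D (face_of w D)) /\
  (forall X, one_face D X -> exists! w, P w /\ face_of w D = X).

Definition IKND (R : realType) (D : set 'rV[R]_2) (P : set 'rV[rat]_2)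
    (f : mixedPoly R) : Prop :=
  (forall w, P w -> (wdeg w D <= wdeg w (msupport f))%E) /\
  (forall X, face D X -> inner X ->
    forall I : {set 'I_2}, I != finset.set0 ->
      X `&` coord_subspace I !=set0 ->
      critical (mpart X f) `&` zeros (mpart X f) `&` Cstar I = set0).

Definition nice (R : realType) (D : set 'rV[R]_2) (g : mixedPoly R) : Prop :=
  forall X, zero_face D X -> inner X ->
    zeros (mpart X g) `&` Cstar [set: 'I_2]%SET = set0.

(* Real-analyticity of a map R^2 -> R: near every point the map is the sum of
   an absolutely convergent power series in two variables, here grouped by
   total degree. *)
Definition real_analytic2 (R : realType) (h : R -> R -> R) : Prop :=
  forall s0 t0 : R, exists (a : nat -> nat -> R) (r : R), 0 < r /\
    forall s t : R, `|s| < r -> `|t| < r ->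
      cvgn (series (fun n : nat =>
        \sum_(j < n.+1) `|a j (n - j)%N * s ^+ j * t ^+ (n - j)|)) /\
      series (fun n : nat =>
        \sum_(j < n.+1) a j (n - j)%N * s ^+ j * t ^+ (n - j)) @ \oo
        --> h (s0 + s) (t0 + t).

Definition real_analyticC (R : realType) (g : R[i] -> R[i]) : Prop :=
  real_analytic2 (fun s t => complex.Re (g (s +i* t))) /\
  real_analytic2 (fun s t => complex.Im (g (s +i* t))).

Definition deformation (R : realType) (f : mixedPoly R)
    (F : R[i] -> mixedPoly R) : Prop :=
  [/\ F 0 = f, (forall e, meval (F e) 0 = 0) &
      forall m : exponent, real_analyticC (fun e => F e m)].

(* Main.v *)
Require Import Defs.
From HB Require Import structures.
From mathcomp Require Import all_boot all_order all_algebra.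
From mathcomp Require Import finmap.
From mathcomp Require Import complex.
From mathcomp Require Import all_classical all_reals all_analysis.
From mathcomp Require Import lra ring.
Import Order.TTheory GRing.Theory Num.Theory.
Import numFieldNormedType.Exports.
Local Open Scope classical_set_scope.
Local Open Scope ring_scope.
Set Implicit Arguments.
Unset Strict Implicit.
Unset Printing Implicit Defensive.

(** For an inner vertex [v] of [D], write [f_v] for the sum of the finitely many
    terms of [f] at [v].  Both halves say that solvability of [f_v = 0] on [(C^* )^2]
    does not change when the coefficients of [f_v] move a little; being real
    analytic in the parameter, these coefficients are continuous
    ([real_analytic2_continuous0]).

    If [f] is not nice, some [f_v] has a zero [x] in [(C^* )^2].  Nondegeneracy
    says that [x] is not critical, so the real differential [R^4 -> R^2] of
    [f_v] at [x] is onto.  The implicit function theorem with parameters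
    ([zeros_persist]) then gives, for every small parameter, a zero close to
    [x], hence still in [(C^* )^2]: [zero_point_persists].  That
    theorem comes from Banach's fixed point theorem, for families that are strictly
    differentiable in [u] uniformly in the parameter ([strictly_diff]).  This
    class is closed under sums and products and contains the coordinates and the
    continuous functions of the parameter, so mixed polynomials with varying
    coefficients belong to it without any computation of derivatives.

    If [f] is nice, [f_v] has no zero on the compact torus
    [|x_1| = |x_2| = 1], and this is stable under perturbation
    ([nice_point_persists]); it extends to [(C^* )^2] because
    [x_k |-> rho_k * x_k], for [rho_k > 0], multiplies [f_v] by
    [rho_1 ^ v_1 * rho_2 ^ v_2].  One neighborhood serves all the vertices at
    once because niceness forces each inner vertex to lie in the finite support
    of [f] ([nice_point_in_support]).

    Parameters are taken in [R * R]; [near0_connected_nbhs] turns a neighborhood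
    of the origin there into a disk of [C]. *)

(** * Families strictly differentiable uniformly in a parameter *)

(** The joint structure on which Banach's fixed point theorem is stated. *)
HB.instance Definition _ (R : realType) (m n : nat) :=
  Complete.on 'M[R]_(m, n).

Lemma coord_le_norm (R : realType) (n : nat) (u : 'rV[R]_n) (j : 'I_n) :
  `|u 0 j| <= `|u|.
Proof.
rewrite /Num.norm/= mx_normrE.
by apply: (le_bigmax _ (fun k : 'I_1 * 'I_n => `|u k.1 k.2|) (0, j)).
Qed.

Lemma norm_le_coord (R : realType) (n : nat) (u : 'rV[R]_n) (e : R) :
  0 <= e -> (forall j, `|u 0 j| <= e) -> `|u| <= e.
Proof.
move=> e0 ue; rewrite /Num.norm/= mx_normrE.
by apply: bigmax_le => // -[i j] _ /=; rewrite ord1.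
Qed.

Lemma norm_mulmx_le (R : realType) (m n : nat) (B : 'M[R]_(m, n)) :
  exists2 C : R, 0 < C & forall y : 'rV[R]_m, `|y *m B| <= C * `|y|.
Proof.
exists (1 + \sum_i \sum_j `|B i j|).
  by rewrite ltr_pwDl// sumr_ge0// => i _; rewrite sumr_ge0.
move=> y; apply: norm_le_coord.
  by rewrite mulr_ge0// addr_ge0// sumr_ge0// => i _; rewrite sumr_ge0.
move=> j; rewrite mxE (le_trans (ler_norm_sum _ _ _))//.
rewrite mulrDl mul1r ler_wpDl// mulr_suml ler_sum// => i _.
rewrite normrM mulrC ler_pM ?coord_le_norm//.
by rewrite (bigD1 j)//= lerDl sumr_ge0.
Qed.

(** Strict differentiability of [h i] at [u0] with differential [l], locally
    uniform in the parameter [i] near [i0].  Bounding the increment between two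
    moving points [p.2.1] and [p.2.2], rather than between [u0] and one moving
    point, is what makes the remainder of a family a contraction. *)
Definition strictly_diff (R : realType) (n : nat) (I : topologicalType)
    (h : I -> 'rV[R]_n -> R) (i0 : I) (u0 : 'rV[R]_n) (l : 'cV[R]_n) :=
  {for (i0, u0), continuous (fun p : I * 'rV[R]_n => h p.1 p.2)} /\
  forall eta : R, 0 < eta ->
    \forall p \near (i0, (u0, u0)) : I * ('rV[R]_n * 'rV[R]_n),
      `|h p.1 p.2.1 - h p.1 p.2.2 - ((p.2.1 - p.2.2) *m l) 0 0|
        <= eta * `|p.2.1 - p.2.2|.

Lemma strictly_diff_param (R : realType) (n : nat) (I : topologicalType)
    (c : I -> R) (i0 : I) (u0 : 'rV[R]_n) :
  {for i0, continuous c} -> strictly_diff (fun i _ => c i) i0 u0 0.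
Proof.
move=> cc; split.
  exact: (@cvg_comp _ _ _ fst c _ (nbhs i0) _ cvg_fst cc).
move=> eta eta0; near=> p.
by rewrite mulmx0 mxE subrr subr0 normr0 mulr_ge0// ltW.
Unshelve. all: by end_near. Qed.

Lemma strictly_diff_coord (R : realType) (n : nat) (I : topologicalType)
    (j : 'I_n) (i0 : I) (u0 : 'rV[R]_n) :
  strictly_diff (fun _ u => u 0 j) i0 u0 (delta_mx j 0).
Proof.
split.
  apply: (@cvg_comp _ _ _ snd (fun u : 'rV[R]_n => u 0 j) _ (nbhs u0) _).
    exact: cvg_snd.
  exact: coord_continuous.
move=> eta eta0; near=> p.
by rewrite -colE !mxE subrr normr0 mulr_ge0// ltW.
Unshelve. all: by end_near. Qed.

Lemma strictly_diffD (R : realType) (n : nat) (I : topologicalType)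
    (h1 h2 : I -> 'rV[R]_n -> R) i0 u0 l1 l2 :
  strictly_diff h1 i0 u0 l1 -> strictly_diff h2 i0 u0 l2 ->
  strictly_diff (fun i u => h1 i u + h2 i u) i0 u0 (l1 + l2).
Proof.
move=> [c1 d1] [c2 d2]; split; first exact: cvgD.
move=> eta eta0; have eta2 : 0 < eta / 2 by rewrite divr_gt0.
apply: filterS2 (d1 _ eta2) (d2 _ eta2) => -[i [u v]] /= h h'.
have -> : eta * `|u - v| = eta / 2 * `|u - v| + eta / 2 * `|u - v|.
  by rewrite -mulrDl -splitr.
rewrite mulmxDr mxE.
apply: le_trans (lerD h h'); apply: le_trans (ler_normD _ _).
by rewrite le_eqVlt; apply/orP; left; apply/eqP; congr `|_|; lra.
Qed.

Lemma strictly_diffN (R : realType) (n : nat) (I : topologicalType)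
    (h : I -> 'rV[R]_n -> R) i0 u0 l :
  strictly_diff h i0 u0 l ->
  strictly_diff (fun i u => - h i u) i0 u0 (- l).
Proof.
move=> [c d]; split; first exact: cvgN.
move=> eta eta0; apply: filterS (d _ eta0) => -[i [u v]] /= huv.
by rewrite mulmxN [X in _ - X]mxE -!opprD normrN.
Qed.

Lemma near_pair_points (I U : topologicalType) (i0 : I) (u0 : U)
    (Q : I -> U -> Prop) :
  (\forall p \near (i0, u0) : I * U, Q p.1 p.2) ->
  \forall p \near (i0, (u0, u0)) : I * (U * U), Q p.1 p.2.1 /\ Q p.1 p.2.2.
Proof.
case=> -[A B] /= [nA nB] AB; exists (A, B `*` B) => /=.
  by split=> //; exists (B, B).
by move=> [i [u v]] /= [Ai [Bu Bv]]; split; apply: (AB (_, _)).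
Qed.

(** The Leibniz rule: the increment of a product splits into the two
    remainders and two terms in which a differential is multiplied by a
    deviation from the value at the base point. *)
Lemma strictly_diffM (R : realType) (n : nat) (I : topologicalType)
    (h1 h2 : I -> 'rV[R]_n -> R) i0 u0 l1 l2 :
  strictly_diff h1 i0 u0 l1 -> strictly_diff h2 i0 u0 l2 ->
  strictly_diff (fun i u => h1 i u * h2 i u) i0 u0
    (h1 i0 u0 *: l2 + h2 i0 u0 *: l1).
Proof.
move=> [c1 d1] [c2 d2]; split; first exact: cvgM.
move=> eta eta0; set a1 := h1 i0 u0; set a2 := h2 i0 u0.
have [C1 C1_gt0 hC1] := norm_mulmx_le l1.
have [C2 C2_gt0 hC2] := norm_mulmx_le l2.
pose K := (`|a1| + 1) + C2 + (`|a2| + 1) + C1.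
have K0 : 0 < K by rewrite /K; have := normr_ge0 a1; have := normr_ge0 a2; lra.
pose k := Num.min 1 (eta / K).
have k0 : 0 < k by rewrite lt_min ltr01 divr_gt0.
have k1 : k <= 1 by rewrite ge_min lexx.
have kK : k * K <= eta by rewrite -ler_pdivlMr// ge_min lexx orbT.
have := c1; rewrite /prop_for /continuous_at => /cvgrPdist_le/(_ _ k0).
rewrite -/a1 /=.
move=> /(near_pair_points (Q := fun i u => `|a1 - h1 i u| <= k)) n1.
have := c2; rewrite /prop_for /continuous_at => /cvgrPdist_le/(_ _ k0).
rewrite -/a2 /=.
move=> /(near_pair_points (Q := fun i u => `|a2 - h2 i u| <= k)) n2.
apply: filterS2 (filterI n1 n2) (filterI (d1 _ k0) (d2 _ k0)) => -[i [u v]] /=.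
move=> [[e1 _] [_ e2]] [D1 D2].
have {hC1}L1 : `|((u - v) *m l1) 0 0| <= C1 * `|u - v|.
  exact: le_trans (coord_le_norm _ _) (hC1 _).
have {hC2}L2 : `|((u - v) *m l2) 0 0| <= C2 * `|u - v|.
  exact: le_trans (coord_le_norm _ _) (hC2 _).
have -> : ((u - v) *m (a1 *: l2 + a2 *: l1)) 0 0 =
    a1 * ((u - v) *m l2) 0 0 + a2 * ((u - v) *m l1) 0 0.
  by rewrite mulmxDr -!scalemxAr [LHS]mxE [X in X + _]mxE [X in _ + X]mxE.
move: D1 D2 L1 L2; set w1 := (_ *m l1) 0 0; set w2 := (_ *m l2) 0 0.
set N := `|u - v| => D1 D2 L1 L2.
have N0 : 0 <= N by exact: normr_ge0.
have b1 : `|h1 i u| <= `|a1| + 1.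
  rewrite -(subKr a1 (h1 i u)) (le_trans (ler_normB _ _))// lerD2l.
  exact: le_trans e1 k1.
have b2 : `|h2 i v| <= `|a2| + 1.
  rewrite -(subKr a2 (h2 i v)) (le_trans (ler_normB _ _))// lerD2l.
  exact: le_trans e2 k1.
(* the classical splitting of the increment of a product *)
have -> : h1 i u * h2 i u - h1 i v * h2 i v - (a1 * w2 + a2 * w1) =
    h1 i u * (h2 i u - h2 i v - w2) - (a1 - h1 i u) * w2 +
    h2 i v * (h1 i u - h1 i v - w1) - (a2 - h2 i v) * w1 by ring.
apply: (@le_trans _ _ (k * K * N)); last by rewrite ler_wpM2r.
rewrite (_ : k * K * N = (`|a1| + 1) * (k * N) + k * (C2 * N) +
  (`|a2| + 1) * (k * N) + k * (C1 * N)); last by rewrite /K; ring.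
apply: le_trans (ler_normB _ _) (lerD _ _); last by rewrite normrM ler_pM.
apply: le_trans (ler_normD _ _) (lerD _ _); last by rewrite normrM ler_pM.
by apply: le_trans (ler_normB _ _) (lerD _ _); rewrite normrM ler_pM.
Qed.

(** * Persistence of zeros with surjective differential *)

(** The zeros of [g] are the fixed points of [y |-> y - g y], a contraction of
    ratio [1/2]; it sends [0] to distance at most [d / 2] from [0], hence maps the
    ball of radius [d] into itself. *)
Lemma small_contraction_zero (R : realType) (m : nat) (g : 'rV[R]_m -> 'rV[R]_m)
    (d : R) :
  0 < d -> `|g 0| <= d / 2 ->
  (forall y z, `|y| <= d -> `|z| <= d ->
    `|g y - g z - (y - z)| <= 2^-1 * `|y - z|) ->
  exists2 y, `|y| <= d & g y = 0.
Proof.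
move=> d0 g0 glip; pose U := [set y : 'rV[R]_m | `|y| <= d].
pose G y := y - g y.
have Glip y z : `|y| <= d -> `|z| <= d -> `|G y - G z| <= 2^-1 * `|y - z|.
  move=> yd zd; have -> : G y - G z = - (g y - g z - (y - z)).
    by apply/rowP => j; rewrite !mxE; ring.
  by rewrite normrN glip.
have GU : set_fun U U G.
  move=> y /= yd; rewrite /U /= -[G y](subrK (G 0)).
  rewrite (le_trans (ler_normD _ _))// [leRHS]splitr lerD//; last first.
    by rewrite /G sub0r normrN.
  rewrite (le_trans (Glip _ _ _ _))// ?normr0 ?(ltW d0)//.
  by rewrite subr0 mulrC ler_wpM2r.
pose Gf : {fun U >-> U} := HB.pack G (isFun.Build _ _ U U G GU).
have [] := @banach_fixed_point R 'rV[R]_m U Gf.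
- have h0 : 0 <= 2^-1 :> R by rewrite invr_ge0.
  exists (NngNum h0); split=> /=; first by rewrite invf_lt1// ltr1n.
  by move=> [y z] [/= yd zd]; exact: Glip.
- exact: (closed_comp (fun x _ => @norm_continuous _ _ x) (@closed_le _ d)).
- by exists 0; rewrite /U /= normr0 ltW.
move=> y yd yG; exists y => //; move: yG => /eqP.
by rewrite /= /G -subr_eq0 opprB addrC subrK => /eqP.
Qed.

(** The existence part of the implicit function theorem with parameters.  If
    [B] is a left inverse of the differential [A] (row vectors are multiplied on
    the right), the restriction of [h i] to the affine space [u0 + y *m B] is a
    small perturbation of the identity in [y], for all [i] near [i0]. *)
Lemma zeros_persist (R : realType) (n m : nat) (I : topologicalType)
    (h : 'I_m -> I -> 'rV[R]_n -> R) (i0 : I) (u0 : 'rV[R]_n)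
    (A : 'M[R]_(n, m)) (e : R) :
  row_full A -> (forall j, strictly_diff (h j) i0 u0 (col j A)) ->
  (forall j, h j i0 u0 = 0) -> 0 < e ->
  \forall i \near i0, exists2 u, `|u - u0| < e & forall j, h j i u = 0.
Proof.
move=> /row_fullP[B BA] hA h0 e0.
have [C C0 hC] := norm_mulmx_le B.
have eta0 : 0 < (2 * C)^-1 by rewrite invr_gt0 mulr_gt0.
have := filter_forall _ (fun j => (hA j).2 _ eta0).
move=> [[V W] /= [nV [[W1 W2] /= [nW1 nW2] W12]] VW].
have : nbhs u0 (W1 `&` W2) by exact: filterI.
move=> /nbhs_ballP[r /= r0 hr].
(* [C * d] is half of [Num.min r e], so that [u0 + y *m B] stays in both balls *)
pose d := Num.min r e / (2 * C).
have re0 : 0 < Num.min r e by rewrite lt_min r0 e0.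
have d0 : 0 < d by rewrite divr_gt0// mulr_gt0.
have Cd (y : 'rV[R]_m) : `|y| <= d -> `|y *m B| < Num.min r e.
  move=> yd; rewrite (le_lt_trans (hC y))//.
  rewrite (@le_lt_trans _ _ (C * d))// ?ler_wpM2l ?(ltW C0)//.
  have -> : C * d = Num.min r e / 2 by rewrite /d; field; rewrite gt_eqF.
  by rewrite ltr_pdivrMr// ltr_pMr// ltr1n.
have small : \forall i \near i0, forall j, `|h j i u0| <= d / 2.
  apply: filter_forall => j; have d2 : 0 < d / 2 by rewrite divr_gt0.
  have := (hA j).1; rewrite /prop_for /continuous_at /= h0.
  move=> /cvgrPdist_le/(_ _ d2)[[V' W'] /= [nV' nW'] VW'].
  apply: filterS nV' => i Vi; have := VW' (i, u0).
  by rewrite /= sub0r normrN; apply; split=> //=; exact: nbhs_singleton.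
apply: filterS2 nV small => i Vi hi.
pose g (y : 'rV[R]_m) : 'rV[R]_m := \row_j h j i (u0 + y *m B).
have Wy (y : 'rV[R]_m) : `|y| <= d -> W1 (u0 + y *m B) /\ W2 (u0 + y *m B).
  move=> /Cd; rewrite lt_min => /andP[yr _]; apply: hr.
  by rewrite -ball_normE /ball_/= opprD addNKr normrN.
have [||y yd gy] := @small_contraction_zero _ _ g d d0.
- apply: norm_le_coord; first by rewrite divr_ge0// ltW.
  by move=> j; rewrite mxE mul0mx addr0.
- move=> y z yd zd; apply: norm_le_coord; first by rewrite mulr_ge0.
  move=> j; have [Wy1 _] := Wy _ yd; have [_ Wz2] := Wy _ zd.
  have := VW (i, (u0 + y *m B, u0 + z *m B)).
  move=> /(_ (conj Vi (W12 (_, _) (conj Wy1 Wz2))) j)/=.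
  rewrite (_ : u0 + y *m B - _ = (y - z) *m B); last first.
    by rewrite opprD addrACA subrr add0r mulmxBl.
  rewrite colE !mulmxA -(mulmxA _ B) BA mulmx1 -colE.
  rewrite !mxE => /le_trans; apply.
  rewrite (le_trans (ler_wpM2l (ltW eta0) (hC _)))//.
  by rewrite invfM mulrA mulfVK// gt_eqF.
exists (u0 + y *m B).
  by rewrite addrAC subrr add0r; move: (Cd _ yd); rewrite lt_min => /andP[].
by move=> j; have /rowP/(_ j) := gy; rewrite !mxE.
Qed.

(** Freezing the parameter at [i0] and the second point at [u0] leaves the
    usual first-order expansion, which determines the Jacobian. *)
Lemma strictly_diff_jacobian (R : realType) (n m : nat) (I : topologicalType)
    (h : I -> 'rV[R]_n -> 'rV[R]_m) (i0 : I) (u0 : 'rV[R]_n) (A : 'M[R]_(n, m)) :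
  (forall j, strictly_diff (fun i u => h i u 0 j) i0 u0 (col j A)) ->
  jacobian (h i0) u0 = A.
Proof.
move=> hA.
have -> : jacobian (h i0) u0 = lin1_mx (mulmxr A); last first.
  by apply/row_matrixP => k; rewrite !rowE mul_rV_lin1.
rewrite /jacobian; congr lin1_mx.
apply: diff_unique.
  have [C C0 hC] := norm_mulmx_le A.
  apply/linear_bounded_continuous; apply/linear_boundedP.
  apply: filterS (nbhs_pinfty_ge (num_real C)) => M CM y.
  by rewrite (le_trans (hC _))// ler_wpM2r.
apply/eqaddoP => eta eta0 /=.
have := filter_forall _ (fun j => (hA j).2 _ eta0).
move=> [[V W] /= [nV [[W1 W2] /= [nW1 nW2] W12]] VW].
have cs : (fun v : 'rV[R]_n => v + u0) @ 0 --> u0.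
  rewrite -[X in _ --> X]add0r.
  apply: (@cvgD _ _ _ (nbhs (0 : 'rV[R]_n)) _ id (cst u0) 0 u0).
    exact: cvg_id.
  exact: cvg_cst.
have nW1' : nbhs (0 : 'rV[R]_n) [set v | W1 (v + u0)] by exact: cs nW1.
apply: filterS nW1' => v /= Wv.
apply: norm_le_coord; first by rewrite mulr_ge0// ltW.
move=> j.
have := VW (i0, (v + u0, u0)); rewrite /= addrK.
move=> /(_ _ j) h1; rewrite (le_trans _ (h1 _))//; last first.
  split; first exact: nbhs_singleton.
  by apply: W12; split => //; exact: nbhs_singleton.
by rewrite colE mulmxA -colE !mxE opprD addrA.
Qed.

(** * Mixed polynomials with varying coefficients *)

(** The differentials are left existential: only their existence is carried
    through the closure lemmas, and the Jacobian is identified at the end. *)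
Definition strictly_diffC (R : realType) (n : nat) (I : topologicalType)
    (h : I -> 'rV[R]_n -> R[i]%C) (i0 : I) (u0 : 'rV[R]_n) :=
  (exists l, strictly_diff (fun i u => complex.Re (h i u)) i0 u0 l) /\
  (exists l, strictly_diff (fun i u => complex.Im (h i u)) i0 u0 l).

Lemma strictly_diffC_param (R : realType) (n : nat) (I : topologicalType)
    (c : I -> R[i]%C) (i0 : I) (u0 : 'rV[R]_n) :
  {for i0, continuous (fun i => complex.Re (c i))} ->
  {for i0, continuous (fun i => complex.Im (c i))} ->
  strictly_diffC (fun i _ => c i) i0 u0.
Proof. by move=> cR cI; split; exists 0; exact: strictly_diff_param. Qed.

Lemma strictly_diffC_cst (R : realType) (n : nat) (I : topologicalType)
    (z : R[i]%C) (i0 : I) (u0 : 'rV[R]_n) :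
  strictly_diffC (fun _ _ => z) i0 u0.
Proof. by apply: strictly_diffC_param; exact: cst_continuous. Qed.

Lemma strictly_diffC_coord (R : realType) (I : topologicalType)
    (k : 'I_2) (i0 : I) (u0 : 'rV[R]_(2 + 2)) :
  strictly_diffC (fun _ u => R4_to_C2 u 0 k) i0 u0.
Proof.
split.
  exists (delta_mx (lshift 2 k) 0).
  under [fun _ _ => complex.Re _]eq_fun do under eq_fun do rewrite mxE /=.
  exact: strictly_diff_coord.
exists (delta_mx (rshift 2 k) 0).
under [fun _ _ => complex.Im _]eq_fun do under eq_fun do rewrite mxE /=.
exact: strictly_diff_coord.
Qed.

Lemma strictly_diffCJ (R : realType) (n : nat) (I : topologicalType)
    (h : I -> 'rV[R]_n -> R[i]%C) i0 u0 :
  strictly_diffC h i0 u0 -> strictly_diffC (fun i u => (h i u)^*%C) i0 u0.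
Proof.
move=> [[a ha] [b hb]]; split.
  exists a; rewrite (_ : (fun i u => _) = (fun i u => complex.Re (h i u)))//.
  by apply/funext => i; apply/funext => u; case: (h i u).
exists (- b); rewrite (_ : (fun i u => _) = (fun i u => - complex.Im (h i u))).
  exact: strictly_diffN.
by apply/funext => i; apply/funext => u; case: (h i u).
Qed.

Lemma strictly_diffCD (R : realType) (n : nat) (I : topologicalType)
    (h1 h2 : I -> 'rV[R]_n -> R[i]%C) i0 u0 :
  strictly_diffC h1 i0 u0 -> strictly_diffC h2 i0 u0 ->
  strictly_diffC (fun i u => h1 i u + h2 i u) i0 u0.
Proof.
move=> [[a1 ha1] [b1 hb1]] [[a2 ha2] [b2 hb2]]; split.
  exists (a1 + a2); rewrite (_ : (fun i u => _) =
    (fun i u => complex.Re (h1 i u) + complex.Re (h2 i u))).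
    exact: strictly_diffD.
  by apply/funext => i; apply/funext => u; case: (h1 i u); case: (h2 i u).
exists (b1 + b2); rewrite (_ : (fun i u => _) =
  (fun i u => complex.Im (h1 i u) + complex.Im (h2 i u))).
  exact: strictly_diffD.
by apply/funext => i; apply/funext => u; case: (h1 i u); case: (h2 i u).
Qed.

Lemma strictly_diffCM (R : realType) (n : nat) (I : topologicalType)
    (h1 h2 : I -> 'rV[R]_n -> R[i]%C) i0 u0 :
  strictly_diffC h1 i0 u0 -> strictly_diffC h2 i0 u0 ->
  strictly_diffC (fun i u => h1 i u * h2 i u) i0 u0.
Proof.
move=> [[a1 ha1] [b1 hb1]] [[a2 ha2] [b2 hb2]]; split.
  rewrite (_ : (fun i u => _) = (fun i u =>
      complex.Re (h1 i u) * complex.Re (h2 i u) +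
      - (complex.Im (h1 i u) * complex.Im (h2 i u)))); last first.
    by apply/funext => i; apply/funext => u; case: (h1 i u); case: (h2 i u).
  eexists; apply: strictly_diffD; first exact: strictly_diffM ha1 ha2.
  by apply: strictly_diffN; exact: strictly_diffM hb1 hb2.
rewrite (_ : (fun i u => _) = (fun i u =>
    complex.Re (h1 i u) * complex.Im (h2 i u) +
    complex.Im (h1 i u) * complex.Re (h2 i u))); last first.
  by apply/funext => i; apply/funext => u; case: (h1 i u); case: (h2 i u).
eexists; apply: strictly_diffD; first exact: strictly_diffM ha1 hb2.
exact: strictly_diffM hb1 ha2.
Qed.

Lemma strictly_diffCX (R : realType) (n : nat) (I : topologicalType)
    (h : I -> 'rV[R]_n -> R[i]%C) i0 u0 (k : nat) :
  strictly_diffC h i0 u0 -> strictly_diffC (fun i u => h i u ^+ k) i0 u0.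
Proof.
move=> hh; elim: k => [|k IHk].
  by under eq_fun do under eq_fun do rewrite expr0; exact: strictly_diffC_cst.
under eq_fun do under eq_fun do rewrite exprS.
exact: strictly_diffCM.
Qed.

Lemma strictly_diffC_prod (R : realType) (n : nat) (I : topologicalType)
    (J : Type) (s : seq J) (h : J -> I -> 'rV[R]_n -> R[i]%C) i0 u0 :
  (forall j, strictly_diffC (h j) i0 u0) ->
  strictly_diffC (fun i u => \prod_(j <- s) h j i u) i0 u0.
Proof.
move=> hh; elim: s => [|j s IHs].
  by under eq_fun do under eq_fun do rewrite big_nil; exact: strictly_diffC_cst.
under eq_fun do under eq_fun do rewrite big_cons.
exact: strictly_diffCM.
Qed.

Lemma strictly_diffC_sum (R : realType) (n : nat) (I : topologicalType)
    (J : Type) (s : seq J) (h : J -> I -> 'rV[R]_n -> R[i]%C) i0 u0 :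
  (forall j, strictly_diffC (h j) i0 u0) ->
  strictly_diffC (fun i u => \sum_(j <- s) h j i u) i0 u0.
Proof.
move=> hh; elim: s => [|j s IHs].
  by under eq_fun do under eq_fun do rewrite big_nil; exact: strictly_diffC_cst.
under eq_fun do under eq_fun do rewrite big_cons.
exact: strictly_diffCD.
Qed.

Lemma expsum_eqP (R : realType) (m m' : exponent) :
  expsum R m = expsum R m' <->
  (forall k, (m.1 ord0 k + m.2 ord0 k = m'.1 ord0 k + m'.2 ord0 k)%N).
Proof.
split=> [/rowP mm' k|mm'].
  by have := mm' k; rewrite !mxE -!natrD => /eqP; rewrite eqr_nat => /eqP.
by apply/rowP => k; rewrite !mxE -!natrD mm'.
Qed.

(** All exponents with the same [expsum] have entries bounded by the total
    degree. *)
Lemma finite_expsum_fiber (R : realType) (v : 'rV[R]_2) :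
  finite_set [set m : exponent | expsum R m = v].
Proof.
have [[m0 m0v]|nov] := pselect (exists m : exponent, expsum R m = v); last first.
  rewrite (_ : [set _ | _] = set0)//.
  by rewrite -subset0 => m /= mv; apply: nov; exists m.
pose N := \sum_(k < 2) (m0.1 ord0 k + m0.2 ord0 k)%N.
pose q (p : 'rV['I_N.+1]_2 * 'rV['I_N.+1]_2) : exponent :=
  (map_mx val p.1, map_mx val p.2).
apply: (@sub_finite_set _ _ (range q)).
  move=> m /=; rewrite -m0v => /expsum_eqP mm0.
  have mN k : (m.1 ord0 k + m.2 ord0 k <= N)%N.
    by rewrite mm0 /N (bigD1 k)//= leq_addr.
  exists (map_mx inord m.1, map_mx inord m.2) => //.
  rewrite /q /=; case: m mN {mm0} => m1 m2 /= mN; congr pair;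
    apply/rowP => k; rewrite !mxE /= inordK// ltnS (leq_trans _ (mN k))//.
    exact: leq_addr.
  exact: leq_addl.
exact: finite_image.
Qed.

(** Summing over all exponents above [v], instead of over the support of [g],
    gives a range of summation that does not move with [g]. *)
Lemma meval_mpart_point (R : realType) (v : 'rV[R]_2) (g : mixedPoly R)
    (x : 'rV[R[i]%C]_2) :
  meval (mpart [set v] g) x =
  \sum_(m <- fset_set [set m : exponent | expsum R m = v])
    g m * \prod_(k < 2) (x 0 k ^+ m.1 0 k * ((x 0 k)^*)%C ^+ m.2 0 k).
Proof.
have mpE m : mpart [set v] g m = if `[< expsum R m = v >] then g m else 0.
  rewrite /mpart fsfunE; case: ifPn => // /fsfun_dflt ->.
  by case: ifP.
rewrite /meval (big_fset_incl _ (B := fset_set [set m | expsum R m = v])).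
- apply: eq_big_seq => m; rewrite in_fset_set ?inE; last first.
    exact: finite_expsum_fiber.
  by move=> /= mv; rewrite mpE asboolT.
- apply/fsubsetP => m; rewrite mem_finsupp mpE.
  case: asboolP => [mv _|]; last by rewrite eqxx.
  by rewrite in_fset_set ?inE//; exact: finite_expsum_fiber.
- move=> m _ /fsfun_dflt ->; by rewrite mul0r.
Qed.

Lemma strictly_diffC_mpart_point (R : realType) (I : topologicalType)
    (G : I -> mixedPoly R) (v : 'rV[R]_2) (i0 : I) (u0 : 'rV[R]_(2 + 2)) :
  (forall m, {for i0, continuous (fun i => complex.Re (G i m))}) ->
  (forall m, {for i0, continuous (fun i => complex.Im (G i m))}) ->
  strictly_diffC (fun i u => meval (mpart [set v] (G i)) (R4_to_C2 u)) i0 u0.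
Proof.
move=> cR cI; under eq_fun do under eq_fun do rewrite meval_mpart_point.
apply: strictly_diffC_sum => m; apply: strictly_diffCM.
  exact: strictly_diffC_param.
apply: strictly_diffC_prod => k; apply: strictly_diffCM; apply: strictly_diffCX.
  exact: strictly_diffC_coord.
by apply: strictly_diffCJ; exact: strictly_diffC_coord.
Qed.

(** * Neighborhoods of the origin in the parameter plane *)

(** The terms of degree [n >= 1] of the power series scale by [kappa ^ n], hence
    by at most [kappa], when the polyradius is multiplied by [kappa <= 1].  So
    [h - a 0 0] is bounded by [kappa * M] on the shrunk polydisk, where [M] is the
    absolute sum at radius [rho]; [kappa = 0] identifies [h 0 0] with
    [a 0 0]. *)
Lemma real_analytic2_continuous0 (R : realType) (h : R -> R -> R) :
  real_analytic2 h -> {for (0, 0), continuous (fun p : R * R => h p.1 p.2)}.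
Proof.
move=> /(_ 0 0)[a [r [r0 har]]].
pose rho := r / 2.
have rho0 : 0 < rho by rewrite divr_gt0.
have rho_lt : rho < r by rewrite /rho ltr_pdivrMr// ltr_pMr// ltr1n.
pose term s t n := \sum_(j < n.+1) a j (n - j)%N * s ^+ j * t ^+ (n - j).
pose U n := \sum_(j < n.+1) `|a j (n - j)%N * rho ^+ j * rho ^+ (n - j)|.
have U0 n : 0 <= U n by apply: sumr_ge0.
have cU : cvgn (series U).
  by have [|//|] := har rho rho; rewrite ?gtr0_norm.
pose M := limn (series U).
have UM n : series U n <= M.
  apply: nondecreasing_cvgn_le => //; apply/nondecreasing_seqP => k.
  by rewrite !seriesEnat/= big_nat_recr//= lerDl.
have M0 : 0 <= M by rewrite (le_trans _ (UM 0))// seriesEnat/= big_geq.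
have bound kappa s t : 0 <= kappa <= 1 -> `|s| <= kappa * rho ->
    `|t| <= kappa * rho -> `|h s t - a 0 0| <= kappa * M.
  move=> /andP[k0 k1] hs ht.
  have kr : kappa * rho < r.
    by rewrite (le_lt_trans _ rho_lt)// ler_piMl// ltW.
  have [||_] := har s t; rewrite ?(le_lt_trans hs)// ?(le_lt_trans ht)//.
  rewrite !add0r -/(term s t) => ch.
  have : (fun n => `|series (term s t) n - a 0 0|) @ \oo --> `|h s t - a 0 0|.
    by apply: cvg_norm; apply: cvgB => //; exact: cvg_cst.
  apply: (closed_cvg (fun x => x <= kappa * M)); first exact: closed_le.
  exists 1%N => // -[//|n] _ /=.
  rewrite seriesEnat/= big_nat_recl//= /term big_ord1 subnn !expr0 !mulr1.
  rewrite addrAC subrr add0r (le_trans (ler_norm_sum _ _ _))//.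
  apply: le_trans (ler_wpM2l k0 (UM n.+1)).
  rewrite seriesEnat/= big_nat_recl//= mulrDr ler_wpDl ?mulr_ge0//.
  rewrite mulr_sumr ler_sum_nat// => i _.
  rewrite (le_trans (ler_norm_sum _ _ _))// mulr_sumr ler_sum// => -[j /= ji] _.
  rewrite !normrM !normrX (gtr0_norm rho0).
  have E (x : R) : x ^+ i.+1 = x ^+ j * x ^+ (i.+1 - j) by rewrite -exprD subnKC.
  have -> : kappa * (`|a j (i.+1 - j)%N| * rho ^+ j * rho ^+ (i.+1 - j)) =
      `|a j (i.+1 - j)%N| * (kappa * rho ^+ i.+1).
    by rewrite (E rho); ring.
  rewrite -mulrA ler_wpM2l//.
  apply: (@le_trans _ _ ((kappa * rho) ^+ i.+1)).
    rewrite E ler_pM ?exprn_ge0//.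
      by rewrite lerXn2r ?nnegrE ?mulr_ge0// ltW.
    by rewrite lerXn2r ?nnegrE ?mulr_ge0// ltW.
  rewrite exprMn ler_wpM2r ?exprn_ge0 ?(ltW rho0)//.
  by rewrite exprS ler_piMr// exprn_ile1.
have h00 : h 0 0 = a 0 0.
  apply/eqP; rewrite -subr_eq0 -normr_le0.
  by have := bound 0 0 0; rewrite normr0 !mul0r !lexx ler01; exact.
rewrite /prop_for /continuous_at /=; apply/cvgrPdist_le => e e0.
pose kappa := Num.min 1 (e / (M + 1)).
have M1 : 0 < M + 1 by rewrite ltr_wpDl.
have k0 : 0 < kappa by rewrite lt_min ltr01 divr_gt0.
have kM : kappa * M <= e.
  apply: (@le_trans _ _ (kappa * (M + 1))).
    by rewrite ler_wpM2l ?lerDl ?(ltW k0).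
  by rewrite -ler_pdivlMr// ge_min lexx orbT.
have kr0 : 0 < kappa * rho by rewrite mulr_gt0.
have near0 : \forall s \near (0 : R), `|s| <= kappa * rho.
  apply/nbhs_ballP; exists (kappa * rho) => // s.
  by rewrite -ball_normE /ball_ /= sub0r normrN => /ltW.
exists ([set s | `|s| <= kappa * rho], [set s | `|s| <= kappa * rho]) => //.
move=> [s t] [/= hs ht]; rewrite h00 distrC (le_trans _ kM)//.
by apply: bound; rewrite // (ltW k0) ge_min lexx.
Qed.

Lemma norm_real_complex (R : realType) (t : R) : `|t%:C%C| = `|t|%:C%C.
Proof. by rewrite normc_def /= expr0n addr0 sqrtr_sqr. Qed.

Lemma continuous_ray (R : realType) (e : R[i]%C) :
  continuous (fun t : R => t%:C%C * e : (R[i]%C)^o).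
Proof.
move=> t; apply/cvgrPdist_lt => eps; rewrite ltcE => /andP[/eqP epsI epsR].
have -> : eps = (complex.Re eps)%:C%C by case: eps epsI {epsR} => x y /= ->.
move: epsR; set d := complex.Re eps => d0.
have [N N0 eN] : exists2 N : R, 0 <= N & `|e| = N%:C%C.
  exists (Num.sqrt (complex.Re e ^+ 2 + complex.Im e ^+ 2)).
    exact: sqrtr_ge0.
  exact: normc_def.
have c0 : 0 < d / (N + 1) by rewrite divr_gt0// ltr_wpDl.
apply/(@nbhs_normP R R); exists (d / (N + 1)) => //= s; rewrite /ball_ /= => ts.
rewrite -mulrBl -rmorphB normrM norm_real_complex eN -rmorphM ltcR.
apply: (@le_lt_trans _ _ (`|t - s| * (N + 1))); first by rewrite ler_wpM2l// lerDl.
by rewrite -ltr_pdivlMr// ltr_wpDl.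
Qed.

(** A disk is connected as the union of the segments that join its points to
    its center. *)
Lemma near0_connected_nbhs (R : realType) (Q : R * R -> Prop) :
  (\forall p \near ((0, 0) : R * R), Q p) ->
  exists T : set (R[i]%C)^o,
    [/\ connected T, nbhs (0 : (R[i]%C)^o) T &
        forall e, T e -> Q (complex.Re e, complex.Im e)].
Proof.
move=> [[V W] /= [/nbhs_ballP[d1 /= d10 hV] /nbhs_ballP[d2 /= d20 hW]] VW].
pose d := Num.min d1 d2; have d0 : 0 < d by rewrite lt_min d10.
have dC0 : 0 < d%:C%C :> R[i]%C by rewrite ltcR.
exists (ball (0 : (R[i]%C)^o) d%:C%C); split.
- pose seg (e : R[i]%C) (t : R) : (R[i]%C)^o := t%:C%C * e.
  have -> : ball (0 : (R[i]%C)^o) d%:C%C =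
      \bigcup_(e in ball (0 : (R[i]%C)^o) d%:C%C) (seg e @` `[0, 1]).
    apply/seteqP; split=> [e eT|e [e' e'T [t]]].
      exists e => //; exists 1; first by rewrite /= in_itv/= ler01 lexx.
      by rewrite /seg mul1r.
    rewrite /= in_itv/= => /andP[t0 t1] <-; move: e'T.
    rewrite -ball_normE /ball_ /= !sub0r !normrN /seg => e'd.
    rewrite normrM (le_lt_trans _ e'd)// ler_piMl//.
    by rewrite norm_real_complex ger0_norm// -(rmorph1 (real_complex R)) lecR.
  apply: bigcup_connected.
    exists 0 => e _; exists 0; first by rewrite /= in_itv/= lexx ler01.
    by rewrite /seg mul0r.
  move=> e _; apply: connected_continuous_connected; first exact: segment_connected.
  by apply: continuous_subspaceT; exact: continuous_ray.
- exact: nbhsx_ballx.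
- move=> e; rewrite -ball_normE /ball_ /= sub0r normrN normc_def ltcR => ed.
  have le_sqrt (x y : R) : `|x| <= Num.sqrt (x ^+ 2 + y ^+ 2).
    by rewrite -sqrtr_sqr ler_wsqrtr// lerDl sqr_ge0.
  apply: VW; split => /=; [apply: hV|apply: hW];
    rewrite -ball_normE /ball_ /= sub0r normrN.
    rewrite (le_lt_trans (le_sqrt _ (complex.Im e)))// (lt_le_trans ed)//.
    by rewrite ge_min lexx.
  rewrite (le_lt_trans (le_sqrt _ (complex.Re e)))// addrC (lt_le_trans ed)//.
  by rewrite ge_min lexx orbT.
Qed.

(** * Vertex parts of mixed polynomials on the complex torus *)

Lemma C2_to_R4K (R : realType) : cancel (@C2_to_R4 R) (@R4_to_C2 R).
Proof.
move=> x; apply/rowP => k; rewrite !mxE (unsplitK (inl k)) (unsplitK (inr k)) !mxE.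
by case: (x 0 k).
Qed.

(** Radial homogeneity: the degree of [rho k] in the monomial of exponent [m]
    depends on [expsum m] alone. *)
Lemma meval_mpart_point_scale (R : realType) (m0 : exponent) (g : mixedPoly R)
    (rho : 'I_2 -> R) (x y : 'rV[R[i]%C]_2) :
  (forall k, x 0 k = (rho k)%:C%C * y 0 k) ->
  meval (mpart [set expsum R m0] g) x =
  (\prod_(k < 2) (rho k)%:C%C ^+ (m0.1 ord0 k + m0.2 ord0 k)) *
  meval (mpart [set expsum R m0] g) y.
Proof.
move=> xy; rewrite !meval_mpart_point mulr_sumr; apply: eq_big_seq => m.
rewrite in_fset_set ?inE => [/= /expsum_eqP mm0|]; last first.
  exact: finite_expsum_fiber.
rewrite mulrCA -big_split/=; congr *%R; apply: eq_bigr => k _.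
have conjZ (z : R[i]%C) : (((rho k)%:C * z)^* = (rho k)%:C * z^*)%C.
  by case: z => a b; congr Complex; ring.
rewrite xy conjZ -mm0 !exprMn exprD; ring.
Qed.

(** The torus [|x_1| = |x_2| = 1], in the real coordinates of [C2_to_R4]. *)
Definition torus (R : realType) : set 'rV[R]_(2 + 2) :=
  [set u | forall k, u 0 (lshift 2 k) ^+ 2 + u 0 (rshift 2 k) ^+ 2 = 1].

Lemma compact_torus (R : realType) : compact (@torus R).
Proof.
apply: bounded_closed_compact.
  exists 1; split=> // M M1 u uT; apply: norm_le_coord.
    by rewrite ltW// (lt_trans _ M1).
  move=> j; rewrite (le_trans _ (ltW M1))//.
  rewrite -(ler_pXn2r (_ : 0 < 2)%N) ?nnegrE// expr1n real_normK ?num_real//.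
  case: (splitP j) => k jk.
    rewrite (_ : j = lshift 2 k) -?(uT k) ?lerDl ?sqr_ge0//; exact: val_inj.
  rewrite (_ : j = rshift 2 k) -?(uT k) ?lerDr ?sqr_ge0//; exact: val_inj.
rewrite (_ : @torus R = \bigcap_(k in [set: 'I_2])
    (fun u : 'rV[R]_(2 + 2) => u 0 (lshift 2 k) ^+ 2 + u 0 (rshift 2 k) ^+ 2)
      @^-1` [set 1]); last first.
  by apply/seteqP; split=> u uT k; [move=> _|]; exact: uT.
apply: closed_bigI => k _; apply: closed_comp; last exact: closed_eq.
have co j : continuous (fun u : 'rV[R]_(2 + 2) => u 0 j).
  exact: coord_continuous.
have sq j : continuous (fun u : 'rV[R]_(2 + 2) => u 0 j ^+ 2 : R).
  under eq_fun do rewrite expr2.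
  move=> u.
  by apply: (@cvgM _ _ (nbhs u) _ (fun u : 'rV[R]_(2 + 2) => u 0 j)); exact: co.
by move=> u _; apply: (@cvgD _ _ _ (nbhs u)); exact: sq.
Qed.

Lemma torus_Cstar (R : realType) (u : 'rV[R]_(2 + 2)) :
  torus u -> Cstar [set: 'I_2]%SET (R4_to_C2 u).
Proof.
move=> uT k; split=> _; first exact: finset.in_setT.
rewrite mxE; apply/eqP => -[u1 u2].
by have := uT k; rewrite u1 u2 expr0n addr0 => /eqP; rewrite eq_sym oner_eq0.
Qed.

Lemma Cstar_polar (R : realType) (x : 'rV[R[i]%C]_2) :
  Cstar [set: 'I_2]%SET x ->
  exists (rho : 'I_2 -> R) (u : 'rV[R]_(2 + 2)),
    torus u /\ forall k, x 0 k = (rho k)%:C%C * R4_to_C2 u 0 k.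
Proof.
move=> xC.
pose rho k := Num.sqrt (complex.Re (x 0 k) ^+ 2 + complex.Im (x 0 k) ^+ 2).
have s0 k : 0 < complex.Re (x 0 k) ^+ 2 + complex.Im (x 0 k) ^+ 2.
  rewrite lt_neqAle addr_ge0 ?sqr_ge0// andbT eq_sym paddr_eq0 ?sqr_ge0//.
  have := (xC k).2 (finset.in_setT _); apply: contraNN.
  by rewrite !sqrf_eq0; case: (x 0 k) => a b /= /andP[/eqP-> /eqP->].
have rho0 k : rho k != 0 by rewrite gt_eqF// sqrtr_gt0.
exists rho, (C2_to_R4 (\row_k ((rho k)^-1%:C%C * x 0 k))); split.
  move=> k; rewrite !mxE (unsplitK (inl k)) (unsplitK (inr k)) !mxE.
  have := s0 k.
  have : rho k ^+ 2 = complex.Re (x 0 k) ^+ 2 + complex.Im (x 0 k) ^+ 2.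
    by rewrite sqr_sqrtr// ltW.
  have := rho0 k; case: (x 0 k) => a b /=.
  rewrite !mul0r subr0 addr0 !exprMn -mulrDr exprVn => r0 <- _.
  by rewrite mulVf// expf_neq0.
move=> k; rewrite C2_to_R4K mxE mulrA -rmorphM/= mulfV// mul1r//.
Qed.

Lemma near_neq0 (R : realType) (T : topologicalType) (g : T -> R) (x : T) :
  {for x, continuous g} -> g x != 0 -> \forall y \near x, g y != 0.
Proof. by move=> gc gx; apply: cvgr_neq0 gc gx. Qed.

(** On the compact torus nonvanishing is an open condition in the parameter;
    by polar decomposition and homogeneity the torus sees every zero in
    [(C^* )^2]. *)
Lemma nice_point_persists (R : realType) (I : topologicalType)
    (G : I -> mixedPoly R) (i0 : I) (m0 : exponent) :
  (forall m, {for i0, continuous (fun i => complex.Re (G i m))}) ->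
  (forall m, {for i0, continuous (fun i => complex.Im (G i m))}) ->
  zeros (mpart [set expsum R m0] (G i0)) `&` Cstar [set: 'I_2]%SET = set0 ->
  \forall i \near i0,
    zeros (mpart [set expsum R m0] (G i)) `&` Cstar [set: 'I_2]%SET = set0.
Proof.
move=> cR cI noz.
pose h i u := meval (mpart [set expsum R m0] (G i)) (R4_to_C2 u).
have hT : \forall i \near i0, forall u, torus u -> h i u != 0.
  have /compact_near_coveringP := @compact_torus R.
  apply => u uT.
  have : h i0 u != 0.
    apply/eqP => hu; suff : set0 (R4_to_C2 u) by [].
    by rewrite -noz; split => //; exact: torus_Cstar.
  rewrite eq_complex negb_and => hu.
  have [[l1 [c1 _]] [l2 [c2 _]]] :=
    strictly_diffC_mpart_point (expsum R m0) u cR cI.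
  have swap (Q : I -> 'rV[R]_(2 + 2) -> Prop) :
      (\forall p \near (i0, u) : I * 'rV[R]_(2 + 2), Q p.1 p.2) ->
      \forall x' \near u & i \near i0, Q i x'.
    move=> [[V W] /= [nV nW] VW]; exists (W, V) => //.
    by move=> [w i] /= [Ww Vi]; exact: (VW (i, w)).
  apply: (swap (fun i u => h i u != 0)); case/orP: hu => hu.
    have := near_neq0 c1 hu.
    by apply: filterS => -[i w] /= ; rewrite eq_complex negb_and => ->.
  have := near_neq0 c2 hu.
  by apply: filterS => -[i w] /= ; rewrite eq_complex negb_and => ->; rewrite orbT.
apply: filterS hT => i hi; rewrite -subset0 => x [/= zx xC].
have [rho [u [uT xu]]] := Cstar_polar xC.
move: zx; rewrite /zeros /= (meval_mpart_point_scale _ _ xu) => /eqP.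
rewrite mulf_eq0 (negPf (hi u uT)) orbF prodf_seq_eq0 => /hasP[k _ /=].
rewrite expf_eq0 => /andP[_ rk].
by have := (xC k).2 (finset.in_setT _); rewrite xu (eqP rk) mul0r eqxx.
Qed.

(** At a regular zero the two components of [mpart [set v] (G i0)] have
    independent differentials, so that nearby parameters have a zero as close
    to [x] as needed to avoid the coordinate axes. *)
Lemma zero_point_persists (R : realType) (I : topologicalType)
    (G : I -> mixedPoly R) (i0 : I) (v : 'rV[R]_2) (x : 'rV[R[i]%C]_2) :
  (forall m, {for i0, continuous (fun i => complex.Re (G i m))}) ->
  (forall m, {for i0, continuous (fun i => complex.Im (G i m))}) ->
  zeros (mpart [set v] (G i0)) x -> Cstar [set: 'I_2]%SET x ->
  ~ critical (mpart [set v] (G i0)) x ->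
  \forall i \near i0,
    zeros (mpart [set v] (G i)) `&` Cstar [set: 'I_2]%SET !=set0.
Proof.
move=> cR cI zx xC ncx.
set u0 := C2_to_R4 x.
have [[l1 h1] [l2 h2]] := strictly_diffC_mpart_point v u0 cR cI.
pose h i u := C_to_R2 (meval (mpart [set v] (G i)) (R4_to_C2 u)).
pose A : 'M[R]_(2 + 2, 2) := \matrix_(k, j) if j == 0 then l1 k 0 else l2 k 0.
have hA j : strictly_diff (fun i u => h i u 0 j) i0 u0 (col j A).
  have [j0|j0] := eqVneq j 0.
    rewrite (_ : col j A = l1); last by apply/colP => k; rewrite !mxE j0 eqxx.
    suff -> : (fun i u => h i u 0 j) = (fun i u => complex.Re
      (meval (mpart [set v] (G i)) (R4_to_C2 u))) by [].
    by apply/funext => i; apply/funext => u; rewrite mxE j0 eqxx.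
  rewrite (_ : col j A = l2); last by apply/colP => k; rewrite !mxE (negPf j0).
  suff -> : (fun i u => h i u 0 j) = (fun i u => complex.Im
    (meval (mpart [set v] (G i)) (R4_to_C2 u))) by [].
  by apply/funext => i; apply/funext => u; rewrite mxE (negPf j0).
have Jac : jacobian (realification (mpart [set v] (G i0))) u0 = A.
  exact: strictly_diff_jacobian hA.
have Afull : row_full A.
  move/negP: ncx; rewrite -leqNgt -/u0 Jac /row_full => rk.
  by rewrite eqn_leq rank_leq_col rk.
have hz j : h i0 u0 0 j = 0.
  by rewrite /h C2_to_R4K zx mxE; case: ifP.
have Cnear : \forall u \near u0, Cstar [set: 'I_2]%SET (R4_to_C2 u).
  have : \forall u \near u0, forall k, R4_to_C2 u 0 k != 0.
    apply: (@filter_forall _ _ (fun k u => R4_to_C2 u 0 k != 0) (nbhs u0)) => k.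
    have := (xC k).2 (finset.in_setT _).
    rewrite -{1}(C2_to_R4K x) -/u0 mxE eq_complex negb_and /= => /orP[] h0.
      have := near_neq0 (@coord_continuous _ _ _ _ _ u0) h0.
      by apply: filterS => u; rewrite mxE eq_complex negb_and /= => ->.
    have := near_neq0 (@coord_continuous _ _ _ _ _ u0) h0.
    by apply: filterS => u; rewrite mxE eq_complex negb_and /= => ->; rewrite orbT.
  by apply: filterS => u uk k; split=> // _; exact: finset.in_setT.
have /nbhs_ballP[e /= e0 he] := Cnear.
apply: filterS (zeros_persist Afull hA hz e0) => i [u ue hu].
exists (R4_to_C2 u); split=> /=.
  have := hu 0; have := hu 1; rewrite !mxE /zeros /=.
  by case: (meval _ _) => a b /= -> ->.
by apply: he; rewrite -ball_normE /ball_ /= -normrN opprB.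
Qed.

(** If no exponent of [g] lies above [v], the part of [g] at [v] is zero and
    vanishes at [(1, 1)]. *)
Lemma nice_point_in_support (R : realType) (v : 'rV[R]_2) (g : mixedPoly R) :
  zeros (mpart [set v] g) `&` Cstar [set: 'I_2]%SET = set0 ->
  exists2 m, m \in finsupp g & v = expsum R m.
Proof.
move=> noz; have [//|nov] := pselect (exists2 m, m \in finsupp g & v = expsum R m).
suff : set0 (const_mx 1 : 'rV[R[i]%C]_2) by [].
rewrite -noz; split=> /=; last first.
  by move=> k; rewrite finset.in_setT mxE oner_neq0.
rewrite /zeros /= meval_mpart_point big_seq big1// => m.
rewrite in_fset_set ?inE; last exact: finite_expsum_fiber.
move=> /= mv; rewrite fsfun_dflt ?mul0r//; apply/negP => mg.
by apply: nov; exists m.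
Qed.

Theorem proposition4p25 (R : realType) (D : set 'rV[R]_2)
    (P : set 'rV[rat]_2) (f : mixedPoly R) (F : R[i]%C -> mixedPoly R)
    (hD : Cface_diagram D) (hP : weight_system D P)
    (f0 : meval f 0 = 0) (hf : IKND D P f) (hF : deformation f F) :
  (~ nice D f ->
     exists T : set (R[i]%C)^o,
       [/\ connected T, nbhs (0 : (R[i]%C)^o) T &
           forall e, T e -> ~ nice D (F e)]) /\
  (nice D f ->
     exists T : set (R[i]%C)^o,
       [/\ connected T, nbhs (0 : (R[i]%C)^o) T &
           forall e, T e -> nice D (F e)]).
Proof.
have [F0 _ Fan] := hF.
pose G (p : R * R) := F (Complex p.1 p.2).
have G0 : G (0, 0) = f by exact: F0.
have GE e : G (complex.Re e, complex.Im e) = F e by case: e.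
have cR m : {for (0, 0), continuous (fun p => complex.Re (G p m))}.
  exact: (real_analytic2_continuous0 (Fan m).1).
have cI m : {for (0, 0), continuous (fun p => complex.Im (G p m))}.
  exact: (real_analytic2_continuous0 (Fan m).2).
split=> [nn|nf].
  have [X [zX [iX [x [zx xC]]]]] : exists X, zero_face D X /\ inner X /\
      exists x, zeros (mpart X f) x /\ Cstar [set: 'I_2]%SET x.
    apply: contrapT => noX; apply: nn => X zX iX; rewrite -subset0 => x [zx xC].
    by apply: noX; exists X; do 2!split => //; exists x.
  have [_ [v Xv]] := zX.
  have ncx : ~ critical (mpart X f) x.
    move=> cx; suff : set0 x by [].
    rewrite -(hf.2 X (or_intror zX) iX [set: 'I_2]%SET) //.
      by apply/finset.set0Pn; exists 0; exact: finset.in_setT.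
    by exists v; split; [rewrite Xv|move=> k; rewrite finset.in_setT].
  rewrite Xv -G0 in zx ncx.
  have [T [cT nT TQ]] := near0_connected_nbhs (zero_point_persists cR cI zx xC ncx).
  exists T; split => // e Te ne; have [y [zy yC]] := TQ e Te.
  by suff : set0 y by []; rewrite -(ne X zX iX) Xv -GE.
have near_nice : \forall p \near ((0, 0) : R * R),
    (\bigcap_(m in [set` finsupp f]) [set q : R * R |
      zero_face D [set expsum R m] -> inner [set expsum R m] ->
      zeros (mpart [set expsum R m] (G q)) `&` Cstar [set: 'I_2]%SET = set0]) p.
  apply: (@filter_bigI _ _ _ _ (nbhs ((0, 0) : R * R))) => m _ /=.
  have [[zm im]|nzi] := pselect (zero_face D [set expsum R m] /\
    inner [set expsum R m]).
    have := nf _ zm im; rewrite -G0 => /(nice_point_persists cR cI) hp.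
    by apply: (@filterS _ (nbhs ((0, 0) : R * R)) _ _ _ _ hp) => p hp' _ _.
  by apply: (@nearW _ (nbhs ((0, 0) : R * R))) => p zm im; case: nzi.
have [T [cT nT TQ]] := near0_connected_nbhs near_nice.
exists T; split=> // e Te X zX iX.
have [_ [v Xv]] := zX.
have [m mf vm] : exists2 m, m \in finsupp f & v = expsum R m.
  by apply: nice_point_in_support; rewrite -Xv; exact: nf.
have := TQ e Te m mf; rewrite /= GE -vm -Xv; exact.
Qed.
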